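(* Let $R$ be a commutative ring with a derivation $D_R$. Let $P$ be a finitely generated projective $R$-module and let $D$ be a derivation of $\operatorname{End}_R(P)$ extending $D_R$. Then there is a differential structure $D_P$ on $P$ such that the derivation of $\operatorname{End}_R(P)$ induced from $D_P$ is $D$, i.e. $D(S)=D_PS-SD_P$ for all $S\in\operatorname{End}_R(P)$.
   Context: A derivation $D$ of an $R$-algebra $E$ extends $D_R$ if $D(r\cdot 1)=D_R(r)\cdot 1$ for all $r\in R$. A differential structure on an $R$-module $P$ is an additive endomorphism $D_P$ of $P$ with $D_P(rp)=D_R(r)p+rD_P(p)$ for all $r\in R$, $p\in P$. It induces on $\operatorname{End}_R(P)$ the derivation $S\mapsto D_PS-SD_P$. *)

(* Defs.v *)
From HB Require Import structures.
From mathcomp Require Import all_boot all_algebra.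
From mathcomp Require Import boolp.

Set Implicit Arguments.
Unset Strict Implicit.
Unset Printing Implicit Defensive.

Import GRing.Theory.

Local Open Scope ring_scope.

Record derivation (E : pzRingType) := Derivation {
  derivation_map :> {additive E -> E};
  derivationM : forall x y : E,
    derivation_map (x * y) = derivation_map x * y + x * derivation_map y }.

(* The ring of module endomorphisms may be trivial, so it cannot be an      *)
(* lalgType: its R-algebra structure is given by a pzRingType and an        *)
(* lmodType R instance, together with moduleEnd_scalerAl and                *)
(* moduleEnd_scalerAr.                                                      *)
Definition moduleEnd (R : comPzRingType) (P : lmodType R) : Type :=
  {linear P -> P}.

Section ModuleEnd.
Variables (R : comPzRingType) (P : lmodType R).
Implicit Types (S T U : moduleEnd P) (r : R).

HB.instance Definition _ := gen_eqMixin (moduleEnd P).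
HB.instance Definition _ := gen_choiceMixin (moduleEnd P).

Lemma moduleEndP S T : S =1 T -> S = T.
Proof.
case: S T => [f [[hf] [hf']]] [g [[hg] [hg']]] /= /funext fg.
case: g / fg hg hg' => hg hg'.
by rewrite (Prop_irrelevance hf hg) (Prop_irrelevance hf' hg').
Qed.

Definition moduleEnd_zero : moduleEnd P := (\0 : {linear P -> P}).
Definition moduleEnd_opp S : moduleEnd P := (\- S : {linear P -> P}).
Definition moduleEnd_add S T : moduleEnd P := (S \+ T : {linear P -> P}).
Definition moduleEnd_one : moduleEnd P := (idfun : {linear P -> P}).
Definition moduleEnd_mul S T : moduleEnd P := (S \o T : {linear P -> P}).
Definition moduleEnd_scale r S : moduleEnd P := (r \*: S : {linear P -> P}).

Fact moduleEnd_addA : associative moduleEnd_add.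
Proof. by move=> S T U; apply: moduleEndP => p /=; rewrite addrA. Qed.
Fact moduleEnd_addC : commutative moduleEnd_add.
Proof. by move=> S T; apply: moduleEndP => p /=; rewrite addrC. Qed.
Fact moduleEnd_add0 : left_id moduleEnd_zero moduleEnd_add.
Proof. by move=> S; apply: moduleEndP => p /=; rewrite add0r. Qed.
Fact moduleEnd_addN : left_inverse moduleEnd_zero moduleEnd_opp moduleEnd_add.
Proof. by move=> S; apply: moduleEndP => p /=; rewrite addNr. Qed.

HB.instance Definition _ := GRing.isZmodule.Build (moduleEnd P)
  moduleEnd_addA moduleEnd_addC moduleEnd_add0 moduleEnd_addN.

Fact moduleEnd_mulA : associative moduleEnd_mul.
Proof. by move=> S T U; apply: moduleEndP. Qed.
Fact moduleEnd_mul1l : left_id moduleEnd_one moduleEnd_mul.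
Proof. by move=> S; apply: moduleEndP. Qed.
Fact moduleEnd_mul1r : right_id moduleEnd_one moduleEnd_mul.
Proof. by move=> S; apply: moduleEndP. Qed.
Fact moduleEnd_mulDl : left_distributive moduleEnd_mul +%R.
Proof. by move=> S T U; apply: moduleEndP. Qed.
Fact moduleEnd_mulDr : right_distributive moduleEnd_mul +%R.
Proof. by move=> S T U; apply: moduleEndP => p /=; rewrite linearD. Qed.

HB.instance Definition _ := GRing.Zmodule_isPzRing.Build (moduleEnd P)
  moduleEnd_mulA moduleEnd_mul1l moduleEnd_mul1r moduleEnd_mulDl
  moduleEnd_mulDr.

Fact moduleEnd_scaleA r s S :
  moduleEnd_scale r (moduleEnd_scale s S) = moduleEnd_scale (r * s) S.
Proof. by apply: moduleEndP => p /=; rewrite scalerA. Qed.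
Fact moduleEnd_scale1 : left_id 1 moduleEnd_scale.
Proof. by move=> S; apply: moduleEndP => p /=; rewrite scale1r. Qed.
Fact moduleEnd_scaleDr : right_distributive moduleEnd_scale +%R.
Proof. by move=> r S T; apply: moduleEndP => p /=; rewrite scalerDr. Qed.
Fact moduleEnd_scaleDl S : {morph moduleEnd_scale^~ S : r s / r + s}.
Proof. by move=> r s; apply: moduleEndP => p /=; rewrite scalerDl. Qed.

HB.instance Definition _ := GRing.Zmodule_isLmodule.Build R (moduleEnd P)
  moduleEnd_scaleA moduleEnd_scale1 moduleEnd_scaleDr moduleEnd_scaleDl.

Lemma moduleEnd_addE S T p : (S + T) p = S p + T p. Proof. by []. Qed.
Lemma moduleEnd_oppE S p : (- S) p = - S p. Proof. by []. Qed.
Lemma moduleEnd_oneE p : (1 : moduleEnd P) p = p. Proof. by []. Qed.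
Lemma moduleEnd_mulE S T p : (S * T) p = S (T p). Proof. by []. Qed.
Lemma moduleEnd_scaleE r S p : (r *: S) p = r *: S p. Proof. by []. Qed.

Lemma moduleEnd_scalerAl r S T : r *: (S * T) = (r *: S) * T.
Proof. exact: moduleEndP. Qed.
Lemma moduleEnd_scalerAr r S T : r *: (S * T) = S * (r *: T).
Proof. by apply: moduleEndP => p; rewrite moduleEnd_mulE linearZ. Qed.

End ModuleEnd.

Definition finitely_generated (R : pzRingType) (P : lmodType R) : Prop :=
  exists (n : nat) (e : 'I_n -> P),
    forall p : P, exists c : 'I_n -> R, p = \sum_i c i *: e i.

Definition projective (R : pzRingType) (P : lmodType R) : Prop :=
  forall (M N : lmodType R) (f : {linear M -> N}) (g : {linear P -> N}),
    (forall y : N, exists x : M, f x = y) ->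
    exists h : {linear P -> M}, f \o h =1 g.

Definition extends_derivation (R : comPzRingType) (P : lmodType R)
    (DR : derivation R) (D : derivation (moduleEnd P)) : Prop :=
  forall r : R, D (r *: (1 : moduleEnd P)) = DR r *: (1 : moduleEnd P).

Record diffStructure (R : comPzRingType) (DR : derivation R)
    (P : lmodType R) := DiffStructure {
  diffStructure_map :> {additive P -> P};
  diffStructureZ : forall (r : R) (p : P),
    diffStructure_map (r *: p) = DR r *: p + r *: diffStructure_map p }.

Section Induced.
Variables (R : comPzRingType) (DR : derivation R) (P : lmodType R).
Variable DP : diffStructure DR P.
Implicit Types (S T : moduleEnd P).

Definition commutator_fun S (p : P) : P := DP (S p) - S (DP p).

Fact commutator_fun_linear S : linear (commutator_fun S).
Proof.
move=> r p q; rewrite /commutator_fun linearP !raddfD !diffStructureZ /=.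
rewrite linearD !linearZ /= scalerN opprD -[_ + _ + DP (S q)]addrA.
by rewrite -[- _ - _ - _]addrA addrACA subrr add0r addrACA.
Qed.

HB.instance Definition _ S := GRing.isLinear.Build R P P *:%R
  (commutator_fun S) (commutator_fun_linear S).

Definition induced_map S : moduleEnd P :=
  (commutator_fun S : {linear P -> P}).

Lemma induced_mapE S p : induced_map S p = DP (S p) - S (DP p).
Proof. by []. Qed.

Fact induced_map_additive : zmod_morphism induced_map.
Proof.
move=> S T; apply: moduleEndP => p; rewrite moduleEnd_addE moduleEnd_oppE.
rewrite !induced_mapE !moduleEnd_addE !moduleEnd_oppE raddfB /=.
by rewrite !opprD addrACA.
Qed.

HB.instance Definition _ := GRing.isZmodMorphism.Build (moduleEnd P)
  (moduleEnd P) induced_map induced_map_additive.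

Fact induced_mapM S T :
  induced_map (S * T) = induced_map S * T + S * induced_map T.
Proof.
apply: moduleEndP => p; rewrite moduleEnd_addE !moduleEnd_mulE !induced_mapE.
by rewrite !moduleEnd_mulE raddfB /= addrA subrK.
Qed.

Definition induced_derivation : derivation (moduleEnd P) :=
  Derivation induced_mapM.

Lemma induced_derivation_extends : extends_derivation DR induced_derivation.
Proof.
move=> r; apply: moduleEndP => p; rewrite induced_mapE !moduleEnd_scaleE.
by rewrite !moduleEnd_oneE diffStructureZ addrK.
Qed.

End Induced.

(* Main.v *)
(* Finite generation and projectivity give a dual basis, so P = I P for the
   trace ideal I of P, spanned by the values f x of linear forms f on P. By
   the determinant trick some a = \sum_k f_k x_k in I acts on P as the
   identity. Writing p (x) f for the endomorphism q |-> f(q) p, put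
   D_P(p) := \sum_k D(p (x) f_k)(x_k). Since S (p (x) f) = (S p) (x) f, the
   Leibniz rule gives D_P(S p) = D(S)(a p) + S(D_P p) = D(S) p + S(D_P p);
   this is the claim, and for S = r . 1 it says that D_P is a differential
   structure. *)
From HB Require Import structures.
Require Import Defs.
From mathcomp Require Import all_boot all_algebra.
Import GRing.Theory.
Local Open Scope ring_scope.

Set Implicit Arguments.
Unset Strict Implicit.
Unset Printing Implicit Defensive.

Section Ideal.
Variables (R : comPzRingType) (J : R -> Prop).
Hypotheses (J0 : J 0) (JD : forall a b, J a -> J b -> J (a + b)).
Hypothesis (JM : forall a b, J b -> J (a * b)).

Lemma det_congr n (A B : 'M[R]_n) :
  (forall i j, J (A i j - B i j)) -> J (\det A - \det B).
Proof.
move=> AB; rewrite /determinant -sumrB.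
apply: (big_ind J) => // s _; rewrite -mulrBr; apply: JM.
apply: (big_ind2 (fun a b => J (a - b))) => [|a b c d Jab Jcd|i _].
- by rewrite subrr.
- have -> : a * c - b * d = c * (a - b) + b * (c - d).
    by rewrite !mulrBr [c * a]mulrC [c * b]mulrC addrA subrK.
  by apply: JD; apply: JM.
- exact: AB.
Qed.

End Ideal.

Lemma det_annihilates (R : comPzRingType) (P : lmodType R) n (A : 'M[R]_n)
    (e : 'I_n -> P) :
  (forall i, \sum_j A i j *: e j = 0) -> forall i, \det A *: e i = 0.
Proof.
move=> Ae i; have adjA k : (\adj A *m A) i k = (\det A)%:M i k.
  by rewrite mul_adj_mx.
transitivity (\sum_k (\adj A *m A) i k *: e k).
  rewrite (bigD1 i) //= big1 => [|k ki]; rewrite adjA mxE ?eqxx ?addr0 //.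
  by rewrite eq_sym (negPf ki) scale0r.
under eq_bigr do rewrite mxE scaler_suml.
rewrite exchange_big big1 // => j _.
under eq_bigr do rewrite -scalerA.
by rewrite -scaler_sumr Ae scaler0.
Qed.

Section Module.
Variables (R : comPzRingType) (P : lmodType R).

Definition in_trace_ideal (a : R) : Prop :=
  exists s : seq ({linear P -> R^o} * P), a = \sum_(u <- s) u.1 u.2.

Lemma in_trace_ideal0 : in_trace_ideal 0.
Proof. by exists [::]; rewrite big_nil. Qed.

Lemma in_trace_idealD a b :
  in_trace_ideal a -> in_trace_ideal b -> in_trace_ideal (a + b).
Proof. by move=> [s ->] [t ->]; exists (s ++ t); rewrite big_cat. Qed.

Lemma in_trace_idealM a b : in_trace_ideal b -> in_trace_ideal (a * b).
Proof.
move=> [s ->]; exists [seq (u.1, a *: u.2) | u <- s].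
by rewrite big_map mulr_sumr; apply: eq_bigr => u _; rewrite /= linearZ.
Qed.

Lemma in_trace_ideal_value (f : {linear P -> R^o}) x : in_trace_ideal (f x).
Proof. by exists [:: (f, x)]; rewrite big_seq1. Qed.

Section Combination.
Variables (n : nat) (e : 'I_n -> P).

Definition combination (c : 'rV[R]_n) : P := \sum_i c 0 i *: e i.

Fact combination_linear : linear combination.
Proof.
move=> r c d; rewrite /combination scaler_sumr -big_split /=.
by apply: eq_bigr => i _; rewrite !mxE scalerDl scalerA.
Qed.

HB.instance Definition _ := GRing.isLinear.Build R 'rV[R]_n P *:%R
  combination combination_linear.

End Combination.

Section Coordinate.
Variables (n : nat) (h : {linear P -> 'rV[R]_n}) (i : 'I_n).

Definition coordinate (p : P) : R^o := h p 0 i.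

Fact coordinate_linear : linear coordinate.
Proof. by move=> r p q; rewrite /coordinate linearP !mxE. Qed.

HB.instance Definition _ := GRing.isLinear.Build R P R^o *:%R
  coordinate coordinate_linear.

End Coordinate.

Lemma dual_basis : finitely_generated P -> projective P ->
  exists n (e : 'I_n -> P) (phi : 'I_n -> {linear P -> R^o}),
    forall p, p = \sum_i phi i p *: e i.
Proof.
move=> [n [e eP]] projP.
have e_surj p : exists c, combination e c = p.
  have [c ->] := eP p; exists (\row_i c i).
  by apply: eq_bigr => i _; rewrite mxE.
have [h hP] := projP _ _ (combination e : {linear _ -> _}) idfun e_surj.
exists n, e, (fun i => coordinate h i : {linear P -> R^o}) => p.
by rewrite -[LHS]/(idfun p) -hP.
Qed.

Lemma trace_ideal_unit : finitely_generated P -> projective P ->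
  exists2 a, in_trace_ideal a & forall p : P, a *: p = p.
Proof.
move=> fgP projP; have [n [e [phi eP]]] := dual_basis fgP projP.
pose A : 'M[R]_n := \matrix_(i, j) ((i == j)%:R - phi j (e i)).
have Ae i : \sum_j A i j *: e j = 0.
  under eq_bigr do rewrite mxE scalerBl.
  rewrite sumrB -eP (bigD1 i) //= eqxx scale1r big1 ?addr0 ?subrr // => j ji.
  by rewrite eq_sym (negPf ji) scale0r.
exists (1 - \det A).
  rewrite -(det1 R n); apply: det_congr.
  - exact: in_trace_ideal0.
  - exact: in_trace_idealD.
  - exact: in_trace_idealM.
  - move=> i j; rewrite !mxE opprB addrC subrK.
    exact: in_trace_ideal_value.
move=> p; rewrite scalerBl scale1r {2}(eP p) scaler_sumr big1 ?subr0 // => i _.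
by rewrite scalerA mulrC -scalerA (det_annihilates Ae) scaler0.
Qed.

Section RankOne.
Variables (p : P) (f : {linear P -> R^o}).

Definition rank_one_fun (q : P) : P := f q *: p.

Fact rank_one_linear : linear rank_one_fun.
Proof. by move=> r x y; rewrite /rank_one_fun linearP scalerDl -scalerA. Qed.

HB.instance Definition _ := GRing.isLinear.Build R P P *:%R
  rank_one_fun rank_one_linear.

Definition rank_one : moduleEnd P := (rank_one_fun : {linear P -> P}).

Lemma rank_oneE q : rank_one q = f q *: p. Proof. by []. Qed.

End RankOne.

Lemma rank_oneB f : {morph rank_one^~ f : p q / p - q}.
Proof.
move=> p q; apply: moduleEndP => x.
by rewrite moduleEnd_addE moduleEnd_oppE !rank_oneE scalerBr.
Qed.

Lemma mul_rank_one (S : moduleEnd P) p f :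
  S * rank_one p f = rank_one (S p) f.
Proof.
by apply: moduleEndP => x; rewrite moduleEnd_mulE !rank_oneE linearZ.
Qed.

Section Lift.
Variables (D : derivation (moduleEnd P)) (s : seq ({linear P -> R^o} * P)).

Definition lift_derivation (p : P) : P :=
  \sum_(u <- s) D (rank_one p u.1) u.2.

Fact lift_derivation_additive : zmod_morphism lift_derivation.
Proof.
move=> p q; rewrite /lift_derivation -sumrB; apply: eq_bigr => u _.
by rewrite rank_oneB raddfB moduleEnd_addE moduleEnd_oppE.
Qed.

HB.instance Definition _ := GRing.isZmodMorphism.Build P P
  lift_derivation lift_derivation_additive.

Hypothesis s_unit : forall p : P, (\sum_(u <- s) u.1 u.2) *: p = p.

Lemma lift_derivationE (S : moduleEnd P) p :
  lift_derivation (S p) = D S p + S (lift_derivation p).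
Proof.
rewrite -[in D S p](s_unit p) scaler_suml !linear_sum -big_split.
apply: eq_bigr => u _; rewrite -mul_rank_one derivationM.
by rewrite moduleEnd_addE !moduleEnd_mulE rank_oneE.
Qed.

End Lift.
End Module.

Unset Implicit Arguments.

Theorem corollary1 (R : comPzRingType) (DR : derivation R) (P : lmodType R)
    (P_fg : finitely_generated P) (P_proj : projective P)
    (D : derivation (moduleEnd P)) (D_ext : extends_derivation DR D) :
  exists DP : diffStructure DR P,
    forall S : moduleEnd P, induced_derivation DP S = D S.
Proof.
have [_ [s ->] s_unit] := trace_ideal_unit P_fg P_proj.
have DPZ r p : lift_derivation D s (r *: p) =
    DR r *: p + r *: lift_derivation D s p.
  have := lift_derivationE D s_unit (r *: (1 : moduleEnd P)) p.
  by rewrite D_ext !moduleEnd_scaleE !moduleEnd_oneE.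
exists (@DiffStructure _ _ _ (lift_derivation D s : {additive P -> P}) DPZ).
move=> S; apply: moduleEndP => p.
by rewrite induced_mapE /= (lift_derivationE D s_unit) addrK.
Qed.
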